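(* For every integer base $b\geq 2$ and every positive integer $n$, $$\sum_{0\leq k\leq \log_b n}\ \sum_{0<j<b}\left(\!\left(\frac{n+jb^k}{b^{k+1}}\right)\!\right)=\frac{1}{2}-\frac{n}{b^{m+1}},$$ where the sums are over integers $k$ and $j$, $((x))=x-\lfloor x\rfloor-\frac12$ if $x$ is not an integer and $((x))=0$ if $x$ is an integer, and $m=\lfloor\log_b n\rfloor$ is the position of the leading digit in the $b$-ary expansion of $n$.
   Context: No further notation beyond that introduced in the claim: $((\cdot))$ is the function defined there on real numbers. *)

(* Defs.v *)
From mathcomp Require Export all_boot all_order all_algebra.
From mathcomp Require Export all_classical all_reals all_analysis.

Set Implicit Arguments.
Unset Strict Implicit.
Unset Printing Implicit Defensive.

Import Order.TTheory GRing.Theory Num.Theory.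

Local Open Scope ring_scope.

Definition sawtooth (R : realType) (x : R) : R :=
  if x \is a Num.int then 0 else x - (Num.floor x)%:~R - 2^-1.

Definition logb (R : realType) (b x : R) : R := ln x / ln b.

(* Main.v *)
(** The sawtooth function satisfies the replication formula
    [\sum_(0 <= j < b) ((x + j / b)) = ((b x))]: the difference of both sides
    has period [1 / b], so it suffices to check the formula for
    [0 <= x < 1 / b], where all arguments on the left lie in [0, 1).
    Applied to [x = n / b^(k+1)], it makes the inner sum equal to
    [((n / b^k)) - ((n / b^(k+1)))], so the outer sum telescopes to
    [((n)) - ((n / b^(m+1)))], with [0 < n < b^(m+1)]. *)
Require Import Defs.
From mathcomp Require Import ring lra.
Import Order.TTheory GRing.Theory Num.Theory.

Local Open Scope classical_set_scope.
Local Open Scope ring_scope.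

Section Sawtooth.
Variable R : realType.
Implicit Types x : R.

Lemma sawtooth_int x : x \is a Num.int -> sawtooth x = 0.
Proof. by rewrite /sawtooth => ->. Qed.

Lemma sawtooth_itv01 x : 0 < x < 1 -> sawtooth x = x - 2^-1.
Proof.
move=> /andP[x0 x1].
have fx : Num.floor x = 0 by apply: floor_def; rewrite ltW.
by rewrite /sawtooth intrEfloor fx eq_sym gt_eqF// subr0.
Qed.

Lemma sawtoothD1 x : sawtooth (x + 1) = sawtooth x.
Proof.
rewrite /sawtooth rpredDr ?rpred1// floorDrz ?rpred1// floor1.
by case: ifP => // _; rewrite rmorphD/=; ring.
Qed.

Section Replication.
Variable b : nat.
Hypothesis b0 : (0 < b)%N.

Let defect x := \sum_(0 <= j < b) sawtooth (x + j%:R / b%:R) - sawtooth (b%:R * x).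

Let b_neq0 : b%:R != 0 :> R.
Proof. by rewrite pnatr_eq0 -lt0n. Qed.

(** The shift by [b%:R^-1] moves every index [j] to [j.+1], so the change of the sum telescopes to
    its end terms at [x + 1] and [x], which agree by period 1; the argument [b%:R * x] also moves by
    exactly 1. *)
Let defect_period x : defect (x + b%:R^-1) = defect x.
Proof.
rewrite /defect mulrDr mulfV// sawtoothD1; congr (_ - _).
apply/eqP; rewrite -subr_eq0 -sumrB.
rewrite (eq_bigr (fun j => sawtooth (x + j.+1%:R / b%:R)
                         - sawtooth (x + j%:R / b%:R))); last first.
  by move=> j _; congr (sawtooth _ - _); rewrite -[j.+1]addn1 natrD; field.
by rewrite telescope_sumr// mul0r addr0 divff// sawtoothD1 subrr.
Qed.

Let defect_periodn x k : defect (x + k%:R / b%:R) = defect x.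
Proof.
elim: k => [|k IH]; first by rewrite mul0r addr0.
by rewrite -addn1 natrD mulrDl mul1r addrA defect_period.
Qed.

Let sum_centered (m : nat) :
  \sum_(0 <= j < m) ((j%:R : R) - (m%:R - 1) / 2) = 0.
Proof.
have -> : \sum_(0 <= j < m) ((j%:R : R) - (m%:R - 1) / 2)
    = \sum_(0 <= j < m) (j%:R : R) - (m%:R - 1) / 2 *+ m.
  by rewrite sumrB sumr_const_nat subn0.
have -> : \sum_(0 <= j < m) (j%:R : R) = m%:R * (m%:R - 1) / 2.
  elim: m => [|m IH]; first by rewrite big_geq// !mul0r.
  by rewrite big_nat_recr//= IH -addn1 natrD; field.
by rewrite -mulr_natr; field.
Qed.

Let defect_base x : 0 <= x < b%:R^-1 -> defect x = 0.
Proof.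
have b_gt0 : 0 < b%:R :> R by rewrite ltr0n.
move=> /andP[x0 xb].
have bx1 : b%:R * x < 1 by rewrite mulrC -ltr_pdivlMr// div1r.
(* Positivity is a separate premise because it fails for [j = 0] when [x = 0]. *)
have itv j : (j < b)%N -> 0 < x + j%:R / b%:R -> sawtooth (x + j%:R / b%:R)
    = x + j%:R / b%:R - 2^-1.
  move=> jb pos; apply: sawtooth_itv01; rewrite pos/=.
  rewrite -(ltr_pM2l b_gt0) mulrDr mulrCA divff// !mulr1.
  have : j.+1%:R <= b%:R :> R by rewrite ler_nat.
  by rewrite -[j.+1]addn1 natrD; lra.
have key : \sum_(0 <= j < b) (x + j%:R / b%:R - 2^-1) = b%:R * x - 2^-1.
  (* Centring [j] at the mean of [0, ..., b - 1] makes its contribution vanish by [sum_centered],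
     leaving [b] copies of a constant. *)
  transitivity (\sum_(0 <= j < b)
     (b%:R^-1 * (j%:R - (b%:R - 1) / 2) + (x - b%:R^-1 / 2))).
    by apply: eq_bigr => j _; field.
  rewrite big_split/= -mulr_sumr sum_centered mulr0 add0r sumr_const_nat subn0.
  by rewrite -mulr_natr; field.
rewrite /defect; have [x_gt0|] := boolP (0 < x).
  rewrite [sawtooth (_ * _)]sawtooth_itv01 ?mulr_gt0//.
  rewrite big_nat (eq_bigr (fun j => x + j%:R / b%:R - 2^-1)); last first.
    by move=> j jb; apply: itv => //; rewrite ltr_wpDr// divr_ge0.
  by rewrite -big_nat key subrr.
rewrite -leNgt => x_le0; have xE : x = 0 by apply/le_anti; rewrite x0 x_le0.
(* At [x = 0] the term [j = 0] and the right-hand side are both 0 instead of [- 2^-1]. Cancelling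
   [- 2^-1] from both sides of [key] shows that the remaining terms sum to 0. *)
rewrite {x x0 xb bx1 x_le0}xE in itv key *.
rewrite mulr0 sawtooth_int ?rpred0// subr0.
rewrite big_ltn// mul0r addr0 sawtooth_int ?rpred0// add0r.
rewrite big_nat (eq_bigr (fun j => 0 + j%:R / b%:R - 2^-1)); last first.
  by move=> j /andP[j1 jb]; rewrite itv// add0r divr_gt0// ltr0n.
rewrite big_ltn// mul0r mulr0 addr0 !sub0r -[RHS]addr0 in key.
by rewrite -big_nat (addrI _ key).
Qed.

Lemma sawtooth_replication x :
  \sum_(0 <= j < b) sawtooth (x + j%:R / b%:R) = sawtooth (b%:R * x).
Proof.
have b_gt0 : 0 < b%:R :> R by rewrite ltr0n.
apply/eqP; rewrite -subr_eq0 -/(defect x); apply/eqP.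
have defect_periodz z : defect (x - z%:~R / b%:R) = defect x.
  case: z => k; first by rewrite -(defect_periodn _ k) subrK.
  by rewrite NegzE mulrNz mulNr opprK defect_periodn.
(* With [z] the floor of [b%:R * x], the point [x - z / b] lies in [[0, 1/b)]. *)
rewrite -(defect_periodz (Num.floor (b%:R * x))); apply: defect_base.
have /andP[lo hi] := floor_itv (b%:R * x).
rewrite subr_ge0 ler_pdivrMr// [x * _]mulrC lo ltrBlDr -(ltr_pM2l b_gt0) mulrDr.
rewrite mulrCA !divff// mulr1 addrC.
by rewrite intrD in hi.
Qed.
End Replication.
End Sawtooth.

(** Multiplying by [ln b > 0] compares [ln (b ^ k)] with [ln n], and [ln] is increasing. This
    reduces both the range of [k] and the value of [m] to [trunc_log b n]. *)
Lemma le_logb (R : realType) (b n k : nat) : (1 < b)%N -> (0 < n)%N ->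
  (k%:R <= logb (b%:R : R) n%:R) = (b ^ k <= n)%N.
Proof.
move=> b1 n0; rewrite /logb ler_pdivlMr ?ln_gt0 ?ltr1n// mulr_natl.
have b_gt0 : 0 < b%:R :> R by rewrite ltr0n ltnW.
have n_gt0 : 0 < n%:R :> R by rewrite ltr0n.
by rewrite -lnXn// ler_ln ?posrE ?exprn_gt0// -natrX ler_nat.
Qed.

Lemma floor_logb (R : realType) (b n : nat) : (1 < b)%N -> (0 < n)%N ->
  Num.floor (logb (b%:R : R) n%:R) = trunc_log b n.
Proof.
move=> b1 n0; have /andP[lo hi] := trunc_log_bounds b1 n0.
by apply: floor_def; rewrite -PoszD addn1 -!pmulrn le_logb// lo
  ltNge le_logb// -ltnNge.
Qed.

Theorem corollary11 (R : realType) (b n : nat) (hb : (2 <= b)%N) (hn : (0 < n)%N) :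
  let m : int := Num.floor (logb (b%:R : R) n%:R) in
  \sum_(k \in [set k : nat | k%:R <= logb (b%:R : R) n%:R])
    \sum_(1 <= j < b)
      sawtooth ((n + j * b ^ k)%:R / (b ^ k.+1)%:R : R)
  = 1 / 2 - n%:R / b%:R ^ (m + 1).
Proof.
move=> m; have b0 : (0 < b)%N := ltnW hb.
have b_neq0 : b%:R != 0 :> R by rewrite pnatr_eq0 -lt0n.
pose s k : R := sawtooth (n%:R / (b ^ k)%:R).
have inner k : \sum_(1 <= j < b) sawtooth ((n + j * b ^ k)%:R / (b ^ k.+1)%:R : R)
    = s k - s k.+1.
  have bk0 : (b ^ k)%:R != 0 :> R by rewrite pnatr_eq0 -lt0n expn_gt0 b0.
  have := @sawtooth_replication R b b0 (n%:R / (b ^ k.+1)%:R : R).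
  rewrite big_ltn// mul0r addr0 -/(s k.+1) expnS natrM.
  have -> : b%:R * (n%:R / (b%:R * (b ^ k)%:R)) = n%:R / (b ^ k)%:R :> R by field; apply/andP.
  rewrite -/(s k) => <-; rewrite addrC addKr.
  by apply: eq_bigr => j _; rewrite natrD natrM; congr sawtooth; field; apply/andP.
have -> : [set k : nat | k%:R <= logb (b%:R : R) n%:R] = `I_(trunc_log b n).+1.
  apply/seteqP; split=> k /=; rewrite le_logb// ltnS => h; first exact: trunc_log_max.
  by apply: leq_trans (trunc_logP hb hn); rewrite leq_exp2l.
(* The sign is flipped because [telescope_sumr] expects the later term minus the earlier one. *)
rewrite -fsbig_ord (eq_bigr (fun k : 'I_ _ => - (s k.+1 - s k))); last first.
  by move=> k _; rewrite inner opprB.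
rewrite -(big_mkord xpredT (fun k => - (s k.+1 - s k))) sumrN telescope_sumr//.
(* Since [m] is a nonnegative integer, the integer power [b ^ (m + 1)] becomes a natural one. *)
rewrite /m floor_logb// -PoszD addn1 -exprnP opprB {1}/s expn0 divr1.
rewrite sawtooth_int ?natr_int// /s sawtooth_itv01; first by rewrite natrX; lra.
have B0 : 0 < (b ^ (trunc_log b n).+1)%:R :> R by rewrite ltr0n expn_gt0 b0.
have n_gt0 : 0 < n%:R :> R by rewrite ltr0n.
by rewrite divr_gt0//= ltr_pdivrMr// mul1r ltr_nat trunc_log_ltn.
Qed.
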